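(* Let $A\in\mathbf{C}^{n\times n}$, and let $H_k$ ($k\ge 1$) be the $kn\times kn$ matrices and $B_k$ the $kn\times n$ matrices defined in the context from $A$. Suppose that the nonlinear matrix equation $X+A^{*}\overline{X}^{-1}A=I_{n}$ has a positive definite solution. Then $H_{k}>0$ for all $k\ge 1$, and for every positive definite solution $X$ and every integer $k\geq 1$ there holds $$X>S_{k},\qquad S_{k}:=\begin{cases}B_{k}^{*}\,H_{k}^{-1}\,B_{k}, & k\text{ even},\\[2pt] B_{k}^{*}\,\overline{H}_{k}^{\,-1}\,B_{k}, & k\text{ odd}.\end{cases}$$ Moreover, $S_{k}$ is nondecreasing, namely $S_{k+1}\geq S_{k}$ for all $k\geq 1$.
   Context: Notation: $\overline{M}$, $M^{*}$ denote the entrywise conjugate and the conjugate transpose of a complex matrix $M$; $M>0$ means that $M$ is Hermitian positive definite; $M>N$ and $M\ge N$ refer to the Loewner order on Hermitian matrices. The matrices $H_k\in\mathbf{C}^{kn\times kn}$ are defined recursively by $H_{1}=I_{n}$ and $$H_{k+1}=\begin{bmatrix}H_{k}&\begin{bmatrix}\mathbf{0}\\ A^{*}\end{bmatrix}\\ \begin{bmatrix}\mathbf{0}&A\end{bmatrix}&I_{n}\end{bmatrix}\ (k\text{ odd}),\qquad H_{k+1}=\begin{bmatrix}H_{k}&\begin{bmatrix}\mathbf{0}\\ \overline{A}^{*}\end{bmatrix}\\ \begin{bmatrix}\mathbf{0}&\overline{A}\end{bmatrix}&I_{n}\end{bmatrix}\ (k\text{ even}),$$ where $\mathbf{0}$ denotes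 a zero block of the appropriate size (of size $(k-1)n\times n$ or $n\times(k-1)n$; it is empty when $k=1$, so that $H_2=\begin{bmatrix}I_n&A^*\\ A&I_n\end{bmatrix}$). The matrix $B_k=\begin{bmatrix}\mathbf{0}\\ \overline{A}^{*}\end{bmatrix}\in\mathbf{C}^{kn\times n}$ has last $n\times n$ block $\overline{A}^{*}$ and all other entries zero (for $k=1$, $B_1=\overline{A}^{*}$). *)

(* Defs.v *)
From HB Require Import structures.
From mathcomp Require Import all_boot all_order all_algebra.
From mathcomp Require Export complex.
From mathcomp Require Export reals.

Set Implicit Arguments.
Unset Strict Implicit.
Unset Printing Implicit Defensive.

Import Order.TTheory GRing.Theory Num.Theory.
Local Open Scope ring_scope.
Local Open Scope sesquilinear_scope.

Section MatrixOrder.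
Variable C : numClosedFieldType.

(* [0 < z] and [0 <= z] in a numClosedFieldType entail that [z] is real. *)
Definition posdefmx n (M : 'M[C]_n) : Prop :=
  M \is hermsymmx /\
  forall v : 'cV[C]_n, v != 0 -> 0 < (v ^t* *m M *m v) 0 0.

Definition possemidefmx n (M : 'M[C]_n) : Prop :=
  M \is hermsymmx /\
  forall v : 'cV[C]_n, 0 <= (v ^t* *m M *m v) 0 0.

Definition loewner_lt n (M N : 'M[C]_n) : Prop :=
  [/\ M \is hermsymmx, N \is hermsymmx & posdefmx (N - M)].

Definition loewner_le n (M N : 'M[C]_n) : Prop :=
  [/\ M \is hermsymmx, N \is hermsymmx & possemidefmx (N - M)].

End MatrixOrder.

(* The number [k * n], computed so that [bdim n k.+1] is convertible to
   [bdim n k + n] and the block matrices below need no cast. *)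
Fixpoint bdim (n k : nat) : nat := if k is k'.+1 then (bdim n k' + n)%N else 0%N.

Lemma bdimE n k : bdim n k = (k * n)%N.
Proof. by elim: k => //= k ->; rewrite mulSn addnC. Qed.

Section BlockMatrices.
Variables (C : numClosedFieldType) (n : nat).

(* The column [0; D] and the row [0, D] made of [k] blocks of size [n * n],
   with [D] in the last position; empty for [k = 0]. *)
Definition last_col (D : 'M[C]_n) (k : nat) : 'M[C]_(bdim n k, n) :=
  match k return 'M[C]_(bdim n k, n) with
  | 0 => 0
  | k'.+1 => col_mx 0 D
  end.

Definition last_row (D : 'M[C]_n) (k : nat) : 'M[C]_(n, bdim n k) :=
  match k return 'M[C]_(n, bdim n k) with
  | 0 => 0
  | k'.+1 => row_mx 0 D
  end.

Variable A : 'M[C]_n.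

Definition alt_mx (k : nat) : 'M[C]_n := if odd k then A else map_mx Num.conj A.

(* Meant for [k >= 1].  Starting the recursion from the empty matrix gives
   [Hmx 1 = 1%:M], see [Hmx1]. *)
Fixpoint Hmx (k : nat) : 'M[C]_(bdim n k) :=
  match k return 'M[C]_(bdim n k) with
  | 0 => 0
  | k'.+1 =>
      block_mx (Hmx k')                    (last_col ((alt_mx k') ^t*) k')
               (last_row (alt_mx k') k')   1%:M
  end.

Lemma Hmx1 : Hmx 1 = 1%:M :> 'M[C]_n.
Proof.
apply/matrixP => i j; rewrite /= !mxE; case: splitP => [[]//|i' ei].
rewrite mxE; case: splitP => [[]//|j' ej]; rewrite mxE.
by congr (_ *+ (_ == _)); apply/val_inj.
Qed.

Definition Bmx (k : nat) : 'M[C]_(bdim n k, n) :=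
  last_col ((map_mx Num.conj A) ^t*) k.

Lemma Bmx1 : Bmx 1 = (map_mx Num.conj A) ^t* :> 'M[C]_n.
Proof.
apply/matrixP => i j; rewrite /Bmx /= mxE; case: splitP => [[]//|i' ei].
by congr (_ _ _); apply/val_inj.
Qed.

(* [invmx M = M] for a singular [M]. *)
Definition Smx (k : nat) : 'M[C]_n :=
  (Bmx k) ^t* *m invmx (if odd k then map_mx Num.conj (Hmx k) else Hmx k) *m Bmx k.

Definition is_pd_solution (X : 'M[C]_n) : Prop :=
  posdefmx X /\ X + A ^t* *m invmx (map_mx Num.conj X) *m A = 1%:M.

End BlockMatrices.

(* Main.v *)
Require Import Defs.
From mathcomp Require Import all_boot all_order all_algebra.
From mathcomp Require Import complex reals.
Local Open Scope ring_scope.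
Local Open Scope complex_scope.

(** Write [conj] for entrywise conjugation, [K_k] for [H_k] when [k] is even
    and for [conj H_k] when [k] is odd.  Then [S_k = B_k^* K_k^-1 B_k] for every
    [k], and the two alternating recursions for [H_k] become a single one, starting
    from the empty matrix [K_0]: [K_(k+1)] is [conj K_k] bordered by [A] and the
    identity.  Block inversion turns it into
    [S_(k+1) = conj A (I - conj S_k)^-1 (conj A)^*], starting from [S_0 = 0]
    ([Smx_rec]); the matrix [I - conj S_k] is also the Schur complement
    of [conj K_k] in [K_(k+1)], so its positivity is what makes [K_(k+1)]
    positive definite ([posdef_Kmx_succ]).

    Conjugating the equation gives
    [I - conj S_k = conj (X - S_k) + (conj A)^* X^-1 (conj A)].  Hence if
    [X > S_k], the Hermitian matrix with diagonal blocks [X] and [I - conj S_k] and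
    off-diagonal block [conj A] is positive definite: its Schur complement with
    respect to [X] is [conj (X - S_k)].  Taking the Schur complement
    with respect to the other diagonal block gives [I - conj S_k > 0] and
    [X > S_(k+1)] ([solution_step]).  Induction from [X > 0 = S_0] yields the
    first two claims.  Monotonicity follows by induction as well, because the map
    [S |-> conj A (I - conj S)^-1 (conj A)^*] is nondecreasing, inversion being
    order-reversing on positive definite matrices ([possemidef_invB]), and
    [S_0 = 0 <= S_1]. *)

(** * Hermitian and positive definite matrices *)

Section Positivity.
Import Order.TTheory GRing.Theory Num.Theory.
Local Open Scope sesquilinear_scope.
Variable C : numClosedFieldType.

Local Notation conjmx M := (map_mx (@Num.conj C) M).

Lemma hermP n (M : 'M[C]_n) : reflect (M ^t* = M) (M \is hermsymmx).
Proof. by rewrite is_hermitianmxE expr0 scale1r eq_sym; exact: eqP. Qed.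

Lemma adjM m n p (M : 'M[C]_(m, n)) (N : 'M[C]_(n, p)) :
  (M *m N) ^t* = N ^t* *m M ^t*.
Proof. by rewrite trmx_mul map_mxM. Qed.

Lemma adjD m n (M N : 'M[C]_(m, n)) : (M + N) ^t* = M ^t* + N ^t*.
Proof. by rewrite linearD map_mxD. Qed.

Lemma adjB m n (M N : 'M[C]_(m, n)) : (M - N) ^t* = M ^t* - N ^t*.
Proof. by rewrite linearB map_mxB. Qed.

Lemma adj1 n : (1%:M : 'M[C]_n) ^t* = 1%:M.
Proof. by rewrite trmx1 map_mx1. Qed.

Lemma adjV n (M : 'M[C]_n) : (invmx M) ^t* = invmx (M ^t*).
Proof. by rewrite trmx_inv map_invmx. Qed.

Lemma adj_conj m n (M : 'M[C]_(m, n)) : (conjmx M) ^t* = conjmx (M ^t*).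
Proof. by rewrite map_trmx. Qed.

Lemma adj_block m1 m2 n1 n2 (P : 'M[C]_(m1, n1)) (Q : 'M[C]_(m1, n2))
    (R : 'M[C]_(m2, n1)) (T : 'M[C]_(m2, n2)) :
  (block_mx P Q R T) ^t* = block_mx (P ^t*) (R ^t*) (Q ^t*) (T ^t*).
Proof. by rewrite tr_block_mx map_block_mx. Qed.

Lemma adj_col m1 m2 n (P : 'M[C]_(m1, n)) (Q : 'M[C]_(m2, n)) :
  (col_mx P Q) ^t* = row_mx (P ^t*) (Q ^t*).
Proof. by rewrite tr_col_mx map_row_mx. Qed.

Lemma hermB n (M N : 'M[C]_n) :
  M \is hermsymmx -> N \is hermsymmx -> M - N \is hermsymmx.
Proof. by move=> /hermP hM /hermP hN; apply/hermP; rewrite adjB hM hN. Qed.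

Lemma posdef_semi n (M : 'M[C]_n) : posdefmx M -> possemidefmx M.
Proof.
case=> hM pM; split=> // v; have [->|/pM/ltW //] := eqVneq v 0.
by rewrite mulmx0 mxE.
Qed.

Lemma possemidefD n (M N : 'M[C]_n) :
  possemidefmx M -> possemidefmx N -> possemidefmx (M + N).
Proof.
case=> /hermP hM pM [/hermP hN pN]; split; first by apply/hermP; rewrite adjD hM hN.
by move=> v; rewrite mulmxDr mulmxDl mxE addr_ge0 ?pN ?pM.
Qed.

Lemma possemidef_congr m n (W : 'M[C]_(m, n)) (M : 'M[C]_m) :
  possemidefmx M -> possemidefmx (W ^t* *m M *m W).
Proof.
case=> /hermP hM pM; split; first by apply/hermP; rewrite !adjM hM trmxCK mulmxA.
by move=> v; have := pM (W *m v); rewrite adjM !mulmxA.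
Qed.

Lemma posdef_congr m n (W : 'M[C]_(m, n)) (W' : 'M[C]_(n, m)) (M : 'M[C]_m) :
  W' *m W = 1%:M -> posdefmx M -> posdefmx (W ^t* *m M *m W).
Proof.
move=> W'W [/hermP hM pM]; split.
  by apply/hermP; rewrite !adjM hM trmxCK mulmxA.
move=> v v0; have := pM (W *m v); rewrite adjM !mulmxA; apply.
by apply: contraNneq v0 => /(congr1 (mulmx W')); rewrite mulmxA W'W mul1mx mulmx0 => ->.
Qed.

Lemma quad_conj n (M : 'M[C]_n) (v : 'cV[C]_n) :
  (v ^t* *m conjmx M *m v) 0 0 =
  Num.conj (((conjmx v) ^t* *m M *m conjmx v) 0 0).
Proof.
have -> : (v ^t* *m conjmx M *m v) 0 0 = conjmx ((conjmx v) ^t* *m M *m conjmx v) 0 0.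
  by rewrite !map_mxM adj_conj !map_mxCK.
by rewrite mxE.
Qed.

(** Quadratic forms of Hermitian matrices take real values, which conjugation
    preserves. *)
Lemma possemidef_conj n (M : 'M[C]_n) : possemidefmx M -> possemidefmx (conjmx M).
Proof.
case=> /hermP hM pM; split; first by apply/hermP; rewrite adj_conj hM.
by move=> v; rewrite quad_conj conjC_ge0 pM.
Qed.

Lemma posdef_conj n (M : 'M[C]_n) : posdefmx M -> posdefmx (conjmx M).
Proof.
case=> /hermP hM pM; split; first by apply/hermP; rewrite adj_conj hM.
move=> v v0; have /pM pos : conjmx v != 0.
  by apply: contraNneq v0 => /(congr1 (fun u => conjmx u)); rewrite map_mxCK map_mx0 => ->.
by rewrite quad_conj conj_Creal // gtr0_real.
Qed.

Lemma posdef_unit n (M : 'M[C]_n) : posdefmx M -> M \in unitmx.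
Proof.
case=> /hermP hM pM; rewrite -row_free_unit; apply: inj_row_free => v vM.
apply/eqP; apply: contraT => v0.
have /pM : v ^t* != 0 by apply: contraNneq v0 => h; rewrite -(trmxCK v) h trmx0 map_mx0.
by rewrite trmxCK vM mul0mx mxE ltxx.
Qed.

Lemma posdef_inv n (M : 'M[C]_n) : posdefmx M -> posdefmx (invmx M).
Proof.
move=> pM; have uM := posdef_unit _ _ pM; have /hermP hM := pM.1.
have := posdef_congr _ _ _ _ _ (mulmxV uM) pM.
by rewrite adjV hM mulVmx // mul1mx.
Qed.

Lemma posdef1 n : posdefmx (1%:M : 'M[C]_n).
Proof.
split=> [|v v0]; first by apply/hermP; rewrite adj1.
rewrite mulmx1 mxE lt_def; have pos i : 0 <= v ^t* 0 i * v i 0.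
  by rewrite !mxE mulrC mul_conjC_ge0.
rewrite sumr_ge0 ?andbT //; apply: contraNneq v0 => /eqP; rewrite psumr_eq0 // => /allP h.
apply/eqP/colP => i; have := h i (mem_index_enum i).
by rewrite !mxE mulrC mul_conjC_eq0 => /eqP.
Qed.

Lemma possemidef_gram m n (W : 'M[C]_(m, n)) : possemidefmx (W ^t* *m W).
Proof.
by have := possemidef_congr _ _ W _ (posdef_semi _ _ (posdef1 m)); rewrite mulmx1.
Qed.

(** Inversion reverses the order of positive definite matrices: with [E = P - Q],
    [Q^-1 - P^-1 = P^-1 E P^-1 + (E P^-1)^* Q^-1 (E P^-1)], a sum of two
    congruence transforms of positive semidefinite matrices. *)
Lemma possemidef_invB n (P Q : 'M[C]_n) :
  posdefmx P -> posdefmx Q -> possemidefmx (P - Q) ->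
  possemidefmx (invmx Q - invmx P).
Proof.
move=> pP pQ pE; have uP := posdef_unit _ _ pP; have uQ := posdef_unit _ _ pQ.
have /hermP hP := pP.1; have /hermP hE := pE.1.
pose F := (P - Q) *m invmx P.
have := possemidefD _ _ _ (possemidef_congr _ _ (invmx P) _ pE)
  (possemidef_congr _ _ F _ (posdef_semi _ _ (posdef_inv _ _ pQ))).
have -> : F ^t* = invmx P *m (P - Q) by rewrite adjM adjV hP hE.
rewrite adjV hP.
have QF : invmx Q *m F = invmx Q - invmx P.
  by rewrite mulmxA mulmxBr mulVmx // mulmxBl mul1mx mulmxK.
rewrite -[in X in _ + X]mulmxA QF -mulmxDr [invmx P + _]addrC subrK.
by rewrite mulmxBr mulVmx // mulmxBl mul1mx mulmxK.
Qed.

(** * Schur complements *)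

Lemma posdef_diag m n (P : 'M[C]_m) (T : 'M[C]_n) :
  posdefmx P -> posdefmx T -> posdefmx (block_mx P 0 0 T).
Proof.
move=> pP pT; have /hermP hP := pP.1; have /hermP hT := pT.1.
split; first by apply/hermP; rewrite adj_block hP hT !trmx0 !map_mx0.
move=> v; rewrite -[v]vsubmxK; set x := usubmx v; set y := dsubmx v => v0.
rewrite adj_col mul_row_block !mulmx0 addr0 add0r mul_row_col mxE.
have [x0|x0] := eqVneq x 0.
  rewrite ltr_wpDl //; first exact: (posdef_semi _ _ pP).2.
  by apply: pT.2; apply: contraNneq v0 => y0; rewrite x0 y0 col_mx0.
by rewrite ltr_wpDr //; [exact: (posdef_semi _ _ pT).2 | apply: pP.2].
Qed.

(** Block elimination: the bordered matrix is congruent to the block diagonal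
    matrix of [P] and its Schur complement. *)
Lemma posdef_block m n (P : 'M[C]_m) (B : 'M[C]_(m, n)) (D : 'M[C]_n) :
  posdefmx P -> posdefmx (D - B ^t* *m invmx P *m B) ->
  posdefmx (block_mx P B (B ^t*) D).
Proof.
move=> pP pT; have uP := posdef_unit _ _ pP; have /hermP hP := pP.1.
pose U := block_mx 1%:M (invmx P *m B) 0 1%:M : 'M[C]_(m + n).
pose U' := block_mx 1%:M (- (invmx P *m B)) 0 1%:M : 'M[C]_(m + n).
have U'U : U' *m U = 1%:M.
  by rewrite mulmx_block !mul1mx !mul0mx !mulmx1 mulmx0 !addr0 add0r addrN scalar_mx_block.
have := posdef_congr _ _ _ _ _ U'U (posdef_diag _ _ _ _ pP pT).
rewrite adj_block !adj1 adjM adjV hP trmx0 map_mx0 !mulmx_block.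
rewrite !mul1mx !mul0mx !mulmx1 !mulmx0 !addr0 !add0r mulmxKV // mulKVmx //.
by rewrite mulmxA addrC subrK.
Qed.

(** Both matrices are congruence transforms [W^* M W] of the block matrix [M]:
    [D] by the second block of coordinates, the Schur complement by the [W] with
    first block [I] for which the second block row of [M W] vanishes. *)
Lemma posdef_schur m n (P : 'M[C]_m) (B : 'M[C]_(m, n)) (D : 'M[C]_n) :
  posdefmx (block_mx P B (B ^t*) D) ->
  posdefmx D /\ posdefmx (P - B *m invmx D *m B ^t*).
Proof.
move=> pM.
have pD : posdefmx D.
  have := posdef_congr _ _ (col_mx 0 1%:M) (row_mx 0 1%:M) _ _ pM.
  rewrite mul_row_col adj_col adj1 trmx0 map_mx0 mul_row_block mul_row_col.
  by rewrite !mul0mx !mul1mx !mulmx0 !mulmx1 !add0r; apply.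
split=> //; have uD := posdef_unit _ _ pD.
have := posdef_congr _ _ (col_mx 1%:M (- (invmx D *m B ^t*))) (row_mx 1%:M 0) _ _ pM.
rewrite mul_row_col mul1mx mul0mx addr0 -mulmxA mul_block_col adj_col mul_row_col adj1.
rewrite !mulmx1 !mulmxN mulKVmx // addrN mulmx0 addr0 mul1mx mulmxA; exact.
Qed.

(** The last diagonal block of the inverse of a block matrix is the inverse of
    the Schur complement. *)
Lemma invmx_corner m n (P : 'M[C]_m) (Q : 'M[C]_(m, n)) (R : 'M[C]_(n, m))
    (T : 'M[C]_n) (E F : 'M[C]_n) :
  block_mx P Q R T \in unitmx -> P \in unitmx ->
  T - R *m invmx P *m Q \in unitmx ->
  row_mx 0 E *m invmx (block_mx P Q R T) *m col_mx 0 F =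
  E *m invmx (T - R *m invmx P *m Q) *m F.
Proof.
move=> uM uP; set Z := T - _ => uZ.
have MW : block_mx P Q R T *m col_mx (- (invmx P *m (Q *m (invmx Z *m F)))) (invmx Z *m F)
    = col_mx 0 F.
  rewrite mul_block_col !mulmxN mulKVmx // addNr; congr col_mx.
  by rewrite addrC !mulmxA -!mulmxBl mulmxV ?mul1mx.
by rewrite -MW -mulmxA mulKmx // mul_row_col mul0mx add0r mulmxA.
Qed.

End Positivity.

(** * The matrices of the equation *)

Section Equation.
Import Order.TTheory GRing.Theory Num.Theory.
Local Open Scope sesquilinear_scope.
Variables (C : numClosedFieldType) (n : nat) (A : 'M[C]_n).

Local Notation conjmx M := (map_mx (@Num.conj C) M).
Local Notation Ac := (conjmx A).

Lemma conj_last_col (D : 'M[C]_n) k : conjmx (last_col D k) = last_col (conjmx D) k.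
Proof. by case: k => [|k] /=; rewrite ?map_col_mx map_mx0. Qed.

Lemma conj_last_row (D : 'M[C]_n) k : conjmx (last_row D k) = last_row (conjmx D) k.
Proof. by case: k => [|k] /=; rewrite ?map_row_mx map_mx0. Qed.

Lemma adj_last_col (D : 'M[C]_n) k : (last_col D k) ^t* = last_row (D ^t*) k.
Proof. by case: k => [|k] /=; rewrite ?tr_col_mx ?map_row_mx !trmx0 !map_mx0. Qed.

Lemma adj_last_row (D : 'M[C]_n) k : (last_row D k) ^t* = last_col (D ^t*) k.
Proof. by rewrite -[D in LHS]trmxCK -adj_last_col trmxCK. Qed.

Definition Kmx k : 'M[C]_(bdim n k) := if odd k then conjmx (Hmx A k) else Hmx A k.

(** Conjugating at each step absorbs the alternation between [A] and its
    conjugate. *)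
Lemma Kmx_succ k :
  Kmx k.+1 = block_mx (conjmx (Kmx k)) (last_col (A ^t*) k) (last_row A k) 1%:M.
Proof.
rewrite /Kmx /= /alt_mx; case: (odd k) => /=; first by rewrite map_mxCK.
by rewrite map_block_mx map_mx1 conj_last_col conj_last_row adj_conj !map_mxCK.
Qed.

Lemma Smx_row k :
  Smx A k = last_row Ac k *m invmx (Kmx k) *m last_col (Ac ^t*) k.
Proof. by rewrite /Smx /Bmx adj_last_col trmxCK. Qed.

Lemma conj_Smx k :
  conjmx (Smx A k) = last_row A k *m invmx (conjmx (Kmx k)) *m last_col (A ^t*) k.
Proof.
by rewrite Smx_row !map_mxM conj_last_row conj_last_col adj_conj !map_mxCK map_invmx.
Qed.

Lemma Smx0 : Smx A 0 = 0.
Proof. by rewrite Smx_row mulmx0. Qed.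

Lemma posdef_Kmx0 : posdefmx (Kmx 0).
Proof.
split=> [|v]; first by apply/hermP; apply/matrixP => -[].
by rewrite [v]flatmx0 eqxx.
Qed.

Lemma posdef_Kmx_succ k :
  posdefmx (Kmx k) -> posdefmx (1%:M - conjmx (Smx A k)) -> posdefmx (Kmx k.+1).
Proof.
move=> pK pS; rewrite Kmx_succ -[last_row A k]trmxCK adj_last_row.
apply: posdef_block; first exact: posdef_conj.
by rewrite adj_last_col trmxCK -conj_Smx.
Qed.

(** Only the last diagonal block of [K_(k+1)^-1] meets the nonzero block of
    [B_(k+1)]. *)
Lemma Smx_rec k :
  posdefmx (Kmx k) -> posdefmx (1%:M - conjmx (Smx A k)) ->
  Smx A k.+1 = Ac *m invmx (1%:M - conjmx (Smx A k)) *m Ac ^t*.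
Proof.
move=> pK pS; have uK1 := posdef_unit _ _ _ (posdef_Kmx_succ _ pK pS).
rewrite Smx_row conj_Smx; move: uK1; rewrite Kmx_succ => uK1.
apply: invmx_corner => //; first exact/posdef_unit/posdef_conj.
by rewrite -conj_Smx; exact: posdef_unit.
Qed.

(** * Comparison with a solution *)

(** [X] and [I - conj S] are the diagonal blocks of a bordered matrix whose Schur
    complement with respect to [X] is, by the conjugated equation, [conj (X - S)];
    taking the complement on the other side carries the bound from [S] to its
    successor. *)
Lemma solution_step (X S : 'M[C]_n) :
  is_pd_solution A X -> posdefmx (X - S) ->
  posdefmx (1%:M - conjmx S) /\
  posdefmx (X - Ac *m invmx (1%:M - conjmx S) *m Ac ^t*).
Proof.
case=> pX eqX pXS; apply: posdef_schur; apply: posdef_block => //.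
suff -> : 1%:M - conjmx S - Ac ^t* *m invmx X *m Ac = conjmx (X - S).
  exact: posdef_conj.
have := congr1 (fun M => conjmx M) eqX.
rewrite map_mx1 map_mxD !map_mxM map_invmx -adj_conj map_mxCK => <-.
by rewrite map_mxB addrAC addrK.
Qed.

Lemma solution_bounds (X : 'M[C]_n) k : is_pd_solution A X ->
  posdefmx (Kmx k) /\ posdefmx (X - Smx A k).
Proof.
move=> solX; elim: k => [|k [pK pS]].
  by split; [exact: posdef_Kmx0 | rewrite Smx0 subr0; case: solX].
have [pD pX] := solution_step _ _ solX pS.
by split; [exact: posdef_Kmx_succ | rewrite Smx_rec].
Qed.

Lemma posdef_Hmx (X : 'M[C]_n) k : is_pd_solution A X -> posdefmx (Hmx A k).
Proof.
move=> /solution_bounds-/(_ k)[+ _]; rewrite /Kmx; case: (odd k) => //.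
by move/posdef_conj; rewrite map_mxCK.
Qed.

Lemma Smx_herm (X : 'M[C]_n) k : is_pd_solution A X -> Smx A k \is hermsymmx.
Proof.
move=> solX; have [_ [hXS _]] := solution_bounds _ k solX.
by rewrite -[Smx A k](subKr X); apply: hermB hXS; case: solX => -[].
Qed.

Lemma Smx_lt_solution (X : 'M[C]_n) k : is_pd_solution A X -> loewner_lt (Smx A k) X.
Proof.
move=> solX; split; first exact: Smx_herm solX.
- by case: solX => -[].
- by case: (solution_bounds _ k solX).
Qed.

Lemma Smx_nondecreasing (X : 'M[C]_n) k :
  is_pd_solution A X -> loewner_le (Smx A k) (Smx A k.+1).
Proof.
move=> solX; split; [exact: Smx_herm solX | exact: Smx_herm solX |].
have pK i := (solution_bounds _ i solX).1.
have pD i := (solution_step _ _ solX (solution_bounds _ i solX).2).1.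
elim: k => [|k IHk].
  (* [S_1 = conj A (conj A)^*], a Gram matrix. *)
  rewrite Smx_rec // Smx0 map_mx0 !subr0 invmx1 mulmx1 -{1}(trmxCK Ac).
  exact: possemidef_gram.
rewrite (Smx_rec k.+1) // [X in _ - X](Smx_rec k) // -mulmxBl -mulmxBr -{1}(trmxCK Ac).
apply: possemidef_congr; apply: possemidef_invB => //.
by rewrite opprB addrC addrA subrK -map_mxB; exact: possemidef_conj.
Qed.

End Equation.

Theorem theorem3 (R : realType) (n : nat) (A : 'M[R[i]]_n)
    (hsol : exists X : 'M[R[i]]_n, is_pd_solution A X) :
  [/\ forall k : nat, (1 <= k)%N -> posdefmx (Hmx A k),
      forall X : 'M[R[i]]_n, is_pd_solution A X ->
        forall k : nat, (1 <= k)%N -> loewner_lt (Smx A k) X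
    & forall k : nat, (1 <= k)%N -> loewner_le (Smx A k) (Smx A k.+1)].
Proof.
have [X solX] := hsol; split=> [k _ | Y solY k _ | k _].
- exact: posdef_Hmx solX.
- exact: Smx_lt_solution solY.
- exact: Smx_nondecreasing solX.
Qed.
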